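(* Consider the model in which one observes $(Y_t)_{t\in[0,1]}$ with $dY_t=2\sqrt{f(t)}\,dt+n^{-1/2}dW_t$, $W$ a standard Brownian motion, and let $\mathbb P_f$ be the law of the data. Let $\mathcal G=\{f:[0,1]\to\mathbb R:\ f\ge0,\ f(x)=ax+b\text{ with }|a|+|b|\le2\}$. Then there exists $C>0$ such that $$\liminf_{n\to\infty}\ \inf_{\widehat f_n}\ \sup_{f\in\mathcal G:\ f(0)\le n^{-1/2}}\ \mathbb P_f\Big(\frac{|\widehat f_n(0)-f(0)|}{(n\log n)^{-1/2}}\ge C\Big)>0,$$ where the infimum is over all measurable estimators of $f(0)$ based on the data. *)

(* Defs.v *)
From HB Require Import structures.
From mathcomp Require Import all_boot all_order all_algebra.
From mathcomp Require Import all_classical all_reals all_analysis.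
Set Implicit Arguments. Unset Strict Implicit. Unset Printing Implicit Defensive.
Import Order.TTheory GRing.Theory Num.Theory.
Import numFieldNormedType.Exports.
Local Open Scope classical_set_scope.
Local Open Scope ring_scope.

Section WhiteNoise.
Context {R : realType}.

(* Path space: functions R -> R; only values on [0,1] are relevant.
   Cylinder sets {y | y t \in B}, t in [0,1], B Borel. *)
Definition path_cylinders : set (set (R -> R)) :=
  [set A | exists t (B : set R), 0 <= t <= 1 /\ measurable B /\
                                 A = [set y | B (y t)]].

Definition measurable_estimator (T : (R -> R) -> R) : Prop :=
  forall B : set R, measurable B -> <<s path_cylinders >> (T @^-1` B).

Definition is_std_BM d (Omega : measurableType d) (P : probability Omega R)
    (W : R -> Omega -> R) : Prop :=
  [/\ (forall t, 0 <= t <= 1 -> measurable_fun setT (W t)),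
      (forall w, W 0 w = 0),
      (forall w, {within `[0, 1], continuous (fun t => W t w)}) &
      (forall (k : nat) (t : nat -> R) (B : nat -> set R),
          0 <= t 0%N -> (forall i, (i < k)%N -> t i < t i.+1) -> t k <= 1 ->
          (forall i, measurable (B i)) ->
          P (\bigcap_(i in [set i | (i < k)%N])
                [set w | B i (W (t i.+1) w - W (t i) w)]) =
          (\prod_(i < k) normal_prob 0 (Num.sqrt (t i.+1 - t i)) (B i))%E)].

Definition obs_path d (Omega : measurableType d) (W : R -> Omega -> R)
    (n : nat) (f : R -> R) (w : Omega) : R -> R :=
  fun t => Rintegral lebesgue_measure `[0, t] (fun s => 2 * Num.sqrt (f s))
           + (Num.sqrt n%:R)^-1 * W t w.

Definition class_G : set (R -> R) :=
  [set f | (forall x, 0 <= x <= 1 -> 0 <= f x) /\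
           exists a b : R, (forall x, f x = a * x + b) /\ `|a| + `|b| <= 2].

Definition worst_risk d (Omega : measurableType d) (P : probability Omega R)
    (W : R -> Omega -> R) (C : R) (n : nat) (T : (R -> R) -> R) : \bar R :=
  ereal_sup [set P [set w | C <= `|T (obs_path W n f w) - f 0|
                                   / (Num.sqrt (n%:R * ln n%:R))^-1 ]
            | f in [set f | class_G f /\ f 0 <= (Num.sqrt n%:R)^-1]].

Definition minimax_risk d (Omega : measurableType d) (P : probability Omega R)
    (W : R -> Omega -> R) (C : R) (n : nat) : \bar R :=
  ereal_inf [set worst_risk P W C n T | T in measurable_estimator].

End WhiteNoise.

(* Main.v *)
Require Import Defs.
From HB Require Import structures.
From mathcomp Require Import all_boot all_order all_algebra.
From mathcomp Require Import all_classical all_reals all_analysis.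
From mathcomp Require Import measurable_realfun ring lra.
Import Order.TTheory GRing.Theory Num.Theory.
Import numFieldNormedType.Exports.
Local Open Scope classical_set_scope.
Local Open Scope ring_scope.
Set Implicit Arguments.
Unset Strict Implicit.
Unset Printing Implicit Defensive.

(** Two-point argument. The signals x and x + b with b of order (n log n)^(-1/2)
    have values at 0 a distance b apart, while
    n int_0^1 (2 sqrt(x + b) - 2 sqrt x)^2 dx <= 4 n b^2 ln (1 + 1/b) stays bounded.
    No stochastic integral is needed to compare the two laws. An event depending
    on finitely many times is an event on independent Gaussian increments, and
    for these the inequality (E_1 g)^2 <= a E_0 g^2 follows from Cauchy-Schwarz
    for one increment and tensorizes by Fubini; the constants of the increments
    multiply to at most the exponential of the integral above, whatever the grid.
    Hence P_1(A)^2 <= 2 P_0(A) for all such A, and these events approximate every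
    event of the cylinder sigma-algebra, so no test separates the two laws. *)

(** * Second-moment domination between measures and its products *)

Section L2_domination.
Local Open Scope ereal_scope.
Context {R : realType}.

(** When m1 has a square-integrable density with respect to m0, the least such a is the second
    moment of that density under m0, which for probabilities is 1 plus the chi-square divergence.
    Testing against functions avoids densities of the joint laws. *)
Definition L2_dominated d (T : measurableType d)
    (m1 m0 : {measure set T -> \bar R}) (a : R) : Prop :=
  forall g : T -> \bar R, measurable_fun setT g -> (forall x, 0 <= g x) ->
    (\int[m1]_x g x) ^+ 2 <= a%:E * \int[m0]_x (g x) ^+ 2.

Lemma emeasurable_fun_sqr d (T : measurableType d) (g : T -> \bar R) :
  measurable_fun setT g -> measurable_fun setT (fun x => g x ^+ 2).
Proof.
move=> mg; rewrite (_ : (fun x => _) = (g \* g)); last first.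
  by apply/funext => x; rewrite expe2.
exact: emeasurable_funM.
Qed.

(** By Tonelli, the bound for m applies to the inner integral as a function of x, and the bound for
    n applies to each section of g. *)
Lemma L2_dominated_prod d1 d2 (T1 : measurableType d1) (T2 : measurableType d2)
    (m1 m0 : {sigma_finite_measure set T1 -> \bar R})
    (n1 n0 : {sigma_finite_measure set T2 -> \bar R}) (a b : R) :
  (0 <= a)%R -> (0 <= b)%R ->
  L2_dominated m1 m0 a -> L2_dominated n1 n0 b ->
  L2_dominated (m1 \x n1) (m0 \x n0) (a * b).
Proof.
move=> a0 b0 mD nD g mg g0.
have mg2 := emeasurable_fun_sqr mg.
have g20 x : 0 <= g x ^+ 2 by rewrite expe_ge0.
rewrite !fubini_tonelli1 //.
apply: le_trans.
  apply: mD; first exact: measurable_fun_fubini_tonelli_F.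
  by move=> x; apply: integral_ge0.
rewrite EFinM -muleA; apply: lee_wpmul2l; first by rewrite lee_fin.
rewrite -ge0_integralZl //; last 2 first.
- exact: measurable_fun_fubini_tonelli_F.
- by move=> x _; apply: integral_ge0.
apply: ge0_le_integral => //.
- by move=> x _; rewrite expe_ge0 //; apply: integral_ge0.
- by apply: emeasurable_fun_sqr; exact: measurable_fun_fubini_tonelli_F.
- by apply: measurable_funeM; exact: measurable_fun_fubini_tonelli_F.
- move=> x _; apply: (nD (fun y => g (x, y))) => //.
  exact: measurableT_comp.
Qed.

Definition mfun_of d d' (T : measurableType d) (U : measurableType d')
    (f : T -> U) (mf : measurable_fun setT f) : {mfun T >-> U} :=
  HB.pack f (isMeasurableFun.Build _ _ _ _ _ mf).

(** The joint law agrees with the product law on measurable rectangles, hence everywhere by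
    uniqueness of the product measure. *)
Lemma ge0_integral_independent d d1 d2 (Omega : measurableType d)
    (T1 : measurableType d1) (T2 : measurableType d2) (P : probability Omega R)
    (X : {mfun Omega >-> T1}) (Z : {mfun Omega >-> T2}) :
  (forall A B, measurable A -> measurable B ->
     P (X @^-1` A `&` Z @^-1` B) = P (X @^-1` A) * P (Z @^-1` B)) ->
  forall g : T1 * T2 -> \bar R, measurable_fun setT g -> (forall x, 0 <= g x) ->
  \int[P]_w g (X w, Z w) = \int[distribution P X \x distribution P Z]_z g z.
Proof.
move=> indep g mg g0.
have mXZ : measurable_fun setT (fun w => (X w, Z w)).
  by apply/measurable_fun_pair.
rewrite -[LHS](@ge0_integral_distribution _ _ _ _ _ P (mfun_of mXZ) g)//.
apply: eq_measure_integral => A mA _; apply/esym.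
apply: (@product_measure_unique _ _ _ _ _ (distribution P X) (distribution P Z)
  (distribution P (mfun_of mXZ)) _ A mA).
by move=> B C mB mC; exact: indep.
Qed.

End L2_domination.

(** * Invariance passes from generators to the sigma-algebra *)

Section sigma_algebra_invariance.
Context {T : Type} (e : T -> T -> Prop) (G : set (set T)).
Hypothesis Ge : forall A, G A -> forall x y, e x y -> (A x <-> A y).

(** The sets that do not separate [e]-related points form a sigma-algebra. This is how events are
    shown to depend on finitely many coordinates only. *)
Lemma sigma_algebra_invariant A : <<s G >> A ->
  forall x y, e x y -> (A x <-> A y).
Proof.
move=> GA; suff: <<s G >> `<=` [set A | forall x y, e x y -> (A x <-> A y)].
  by apply.
apply: smallest_sub => //; split => //=.
- by move=> B eB x y /eB xy; split=> -[_ nB]; split => // /xy.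
- by move=> F eF x y exy; split=> -[i _ Fi]; exists i => //; apply/(eF i x y exy).
Qed.

End sigma_algebra_invariance.

(** * Sequences with the sigma-algebra of the first k coordinates *)

Section coordinates.
Local Open Scope ereal_scope.
Context {R : realType}.

Definition rectangles (k : nat) : set (set (nat -> R)) :=
  [set A | exists2 B : nat -> set R, (forall i, measurable (B i)) &
    A = \bigcap_(i in [set i | (i < k)%N]) [set u | B i (u i)]].

(** A model of R^k on the carrier of all sequences: the carrier is the same for every k, so
    induction on k changes only the sigma-algebra. *)
Definition coord_space (k : nat) := g_sigma_algebraType (rectangles k).
HB.instance Definition _ k := Measurable.on (coord_space k).

Lemma rectangles_setI k : setI_closed (rectangles k).
Proof.
move=> _ _ [B mB ->] [C mC ->]; exists (fun i => B i `&` C i).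
  by move=> i; exact: measurableI.
by rewrite -bigcapI.
Qed.

Lemma rectanglesT k : rectangles k setT.
Proof.
exists (fun=> setT) => //.
by apply/seteqP; split.
Qed.

Lemma coord_measurable k i : (i < k)%N ->
  measurable_fun setT (fun u : coord_space k => u i).
Proof.
move=> ik _ B mB; rewrite setTI; apply: sub_sigma_algebra.
exists (fun j => if j == i then B else setT).
  by move=> j; case: ifP.
apply/seteqP; split => [u Bu j jk /=|u /(_ i ik) /=].
  by case: eqP => [->|].
by rewrite eqxx.
Qed.

Lemma measurable_to_coord_space d (T : measurableType d) k
    (X : T -> coord_space k) :
  (forall i, (i < k)%N -> measurable_fun setT (fun x => X x i)) ->
  measurable_fun setT X.
Proof.
move=> mX; apply: (@measurability _ _ T (coord_space k) setT X (rectangles k)) => //.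
move=> _ [_ [B mB ->] <-]; rewrite setTI.
rewrite (_ : _ @^-1` _ =
    \bigcap_(i in [set i | (i < k)%N]) ((fun x => X x i) @^-1` B i)) //.
apply: bigcap_measurableType => i ik.
by rewrite -[X in measurable X]setTI; exact: mX.
Qed.

(** The level set of g through u is measurable, so it cannot separate u from a sequence with the
    same first k coordinates. *)
Lemma coord_space_fun_ext k (g : coord_space k -> \bar R) :
  measurable_fun setT g ->
  forall u v : coord_space k, (forall i, (i < k)%N -> u i = v i) -> g u = g v.
Proof.
move=> mg u v uv.
have := mg measurableT [set g u] (emeasurable_set1 _); rewrite setTI => mA.
pose e (x y : nat -> R) := forall i, (i < k)%N -> x i = y i.
suff inv : forall A, rectangles k A -> forall x y, e x y -> (A x <-> A y).
  by have [/(_ erefl) /= ->] := sigma_algebra_invariant inv mA uv.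
move=> _ [B mB ->] x y exy; split=> h i ik; move: (h i ik) => /=; by rewrite exy.
Qed.

End coordinates.

(** * Independent random variables and tensorization *)

Section independent_sequences.
Local Open Scope ereal_scope.
Context {R : realType} d (Omega : measurableType d) (P : probability Omega R).

Definition independent_upto (k : nat) (X : nat -> Omega -> R) : Prop :=
  forall m, (m <= k)%N -> forall B : nat -> set R, (forall i, measurable (B i)) ->
    P (\bigcap_(i in [set i | (i < m)%N]) [set w | B i (X i w)]) =
    \prod_(i < m) P [set w | B i (X i w)].

Lemma measurable_tuple_of (X : nat -> Omega -> R) k :
  (forall i, measurable_fun setT (X i)) ->
  measurable_fun setT (fun w => X^~ w : coord_space k).
Proof. by move=> mX; apply: measurable_to_coord_space => i _; exact: mX. Qed.

(** For fixed B both sides are finite measures in A. They agree on rectangles, which are stable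
    under intersection and generate the sigma-algebra, so they coincide. *)
Lemma independent_last (X : nat -> Omega -> R) k
    (mX : forall i, measurable_fun setT (X i)) : independent_upto k.+1 X ->
  forall (A : set (coord_space k)) (B : set R), measurable A -> measurable B ->
  P ((fun w => X^~ w) @^-1` A `&` X k @^-1` B) =
  P ((fun w => X^~ w) @^-1` A) * P (X k @^-1` B).
Proof.
move=> indX A B mA mB.
have mXB : measurable (X k @^-1` B) by rewrite -[X in measurable X]setTI; exact: mX.
pose Y := mfun_of (measurable_tuple_of (k := k) mX).
have r0 : (0 <= fine (P (X k @^-1` B)))%R by exact: fine_ge0.
pose m1' : {measure set (coord_space k) -> \bar R} :=
  pushforward (mrestr P mXB) Y.
pose m1 := m1' (measurable_tuple_of (k := k) mX).
pose m2 : {measure set (coord_space k) -> \bar R} := mscale (NngNum r0) (distribution P Y).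
have PBE : P (X k @^-1` B) = (fine (P (X k @^-1` B)))%:E.
  by rewrite fineK// fin_num_measure.
have m2E D : m2 D = P (X k @^-1` B) * P ((fun w => X^~ w) @^-1` D).
  by rewrite [in RHS]PBE.
suff : m1 A = m2 A by rewrite m2E muleC.
apply: (@measure_unique _ _ (coord_space k) (rectangles k) (fun=> setT)) => //.
- exact: rectangles_setI.
- by move=> i; exact: rectanglesT.
- by rewrite bigcup_const.
- move=> _ [C mC ->].
  rewrite m2E /m1 /m1'/= /pushforward/= /mrestr.
  (* Putting B at coordinate k turns the joint event into a rectangle of k.+1 coordinates, whose
     product formula splits off the last factor. *)
  pose D i := if i == k then B else C i.
  have mD i : measurable (D i) by rewrite /D; case: ifP.
  have := indX k.+1 (leqnn _) D mD; rewrite big_ord_recr/=.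
  have -> : [set w | D k (X k w)] = X k @^-1` B by rewrite /D eqxx.
  have DE i : (i < k)%N -> D i = C i by rewrite /D; case: ltngtP.
  under eq_bigr do rewrite DE//.
  rewrite -(indX k (leqnSn _) C mC) muleC => <-.
  congr (P _); apply/seteqP; split => w.
    move=> [h Bw] i /=; rewrite ltnS leq_eqVlt => /predU1P[->|ik].
      by rewrite /D eqxx.
    by rewrite DE//; exact: h.
  move=> h; split=> [i ik|]; last by have := h k (ltnSn _); rewrite /D/= eqxx.
  by have := h i (ltnW ik); rewrite /= DE.
- move=> i; rewrite /m1/= /pushforward/= /mrestr preimage_setT setTI.
  by rewrite ltey_eq fin_num_measure.
Qed.

Lemma ge0_integral_snoc (X : nat -> Omega -> R) k
    (mX : forall i, measurable_fun setT (X i)) : independent_upto k.+1 X ->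
  forall g : coord_space k * R -> \bar R,
    measurable_fun setT g -> (forall x, 0 <= g x) ->
  \int[P]_w g (X^~ w, X k w) =
  \int[distribution P (mfun_of (measurable_tuple_of (k := k) mX)) \x
       distribution P (mfun_of (mX k))]_z g z.
Proof.
move=> indX g mg g0.
rewrite -(ge0_integral_independent (X := mfun_of (measurable_tuple_of (k := k) mX))
  (Z := mfun_of (mX k)))// => A B mA mB.
exact: independent_last.
Qed.

(** Induction on k: independence makes the last coordinate a product factor, and [L2_dominated_prod]
    multiplies its constant to the previous ones. *)
Lemma L2_dominated_independent (X1 X0 : nat -> Omega -> R) (a : nat -> R)
    (mX1 : forall i, measurable_fun setT (X1 i))
    (mX0 : forall i, measurable_fun setT (X0 i)) k :
  independent_upto k X1 -> independent_upto k X0 ->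
  (forall i, 0 <= a i)%R ->
  (forall i, (i < k)%N ->
    L2_dominated (distribution P (mfun_of (mX1 i)))
                 (distribution P (mfun_of (mX0 i))) (a i)) ->
  L2_dominated (distribution P (mfun_of (measurable_tuple_of (k := k) mX1)))
               (distribution P (mfun_of (measurable_tuple_of (k := k) mX0)))
               (\prod_(i < k) a i).
Proof.
move=> + + a0; elim: k => [|k IH] ind1 ind0 dom g mg g0.
  (* With no coordinate visible, g is constant and the inequality is an equality. *)
  pose c := g point.
  have gc : g = cst c.
    by apply/funext => u; apply: (coord_space_fun_ext mg).
  rewrite big_ord0 mul1e gc !integral_cst//= !probability_setT.
  by rewrite !mule1 integral_cst//= probability_setT mule1.
have sub X : independent_upto k.+1 X -> independent_upto k X.
  by move=> ind m mk; apply: ind; rewrite leqW.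
have dom' i : (i < k)%N -> L2_dominated (distribution P (mfun_of (mX1 i)))
                 (distribution P (mfun_of (mX0 i))) (a i).
  by move=> ik; apply: dom; rewrite leqW.
have {}IH := IH (sub _ ind1) (sub _ ind0) dom'.
(* Sequences are left fixed by Phi (u, u k), so the law of k.+1 coordinates is
   the image under Phi of a product law. *)
pose Phi (z : coord_space k * R) : coord_space k.+1 :=
  fun i => if i == k then z.2 else z.1 i.
have mPhi : measurable_fun setT Phi.
  apply: measurable_to_coord_space => i; rewrite /Phi ltnS leq_eqVlt.
  have [-> _|/= _ ik] := eqVneq i k; first exact: measurable_snd.
  exact: (measurableT_comp (coord_measurable ik) measurable_fst).
have PhiE (X : nat -> Omega -> R) w : Phi (X^~ w, X k w) = X^~ w.
  by apply/funext => i; rewrite /Phi; case: eqP => [->|].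
have step (X : nat -> Omega -> R) (mX : forall i, measurable_fun setT (X i)) h :
    independent_upto k.+1 X ->
    measurable_fun setT h -> (forall u, 0 <= h u) ->
    \int[distribution P (mfun_of (measurable_tuple_of (k := k.+1) mX))]_u h u =
    \int[distribution P (mfun_of (measurable_tuple_of (k := k) mX)) \x
       distribution P (mfun_of (mX k))]_z h (Phi z).
  move=> ind mh h0; rewrite ge0_integral_distribution//.
  rewrite -ge0_integral_snoc//; last exact: measurableT_comp.
  by apply: eq_integral => w _ /=; rewrite PhiE.
rewrite !step//; last 2 first.
- exact: emeasurable_fun_sqr.
- by move=> u; rewrite expe_ge0.
rewrite big_ord_recr/=.
apply: (L2_dominated_prod _ _ IH (dom k (ltnSn _)) (g := g \o Phi)) => //.
- by apply: prodr_ge0.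
- exact: measurableT_comp.
- by move=> x; exact: g0.
Qed.

End independent_sequences.

(** * Densities, translations and Cauchy-Schwarz for nonnegative functions *)

Section integration.
Local Open Scope ereal_scope.
Context {R : realType}.
Notation mu := (@lebesgue_measure R).
Import HBNNSimple.

(** The identity holds for indicators by [nuE], for simple functions by linearity, and in general by
    monotone convergence. *)
Lemma ge0_integral_density d (T : measurableType d)
    (m nu : {measure set T -> \bar R}) (p : T -> R) :
  measurable_fun setT p -> (forall x, 0 <= p x)%R ->
  (forall A, measurable A -> nu A = \int[m]_(x in A) (p x)%:E) ->
  forall f : T -> \bar R, measurable_fun setT f -> (forall x, 0 <= f x) ->
  \int[nu]_x f x = \int[m]_x (f x * (p x)%:E).
Proof.
move=> mp p0 nuE f mf f0.
have mpE : measurable_fun setT (EFin \o p) by exact/measurable_EFinP.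
have p0E x : 0 <= (p x)%:E by rewrite lee_fin.
have indicP E : measurable E ->
    \int[nu]_x (\1_E x)%:E = \int[m]_x ((\1_E x)%:E * (p x)%:E).
  move=> mE; rewrite integral_indic//= setIT nuE// integral_mkcond.
  by apply: eq_integral => x _; rewrite epatch_indic/= muleC.
pose f_ := nnsfun_approx measurableT mf.
have nnsfunP n :
    \int[nu]_x (f_ n x)%:E = \int[m]_x ((f_ n x)%:E * (p x)%:E).
  under [LHS]eq_integral do rewrite fimfunE -fsumEFin//.
  rewrite [LHS]ge0_integral_fsum//; last 2 first.
    - by move=> r; exact/measurable_EFinP/measurableT_comp.
    - by move=> r x _; rewrite EFinM nnfun_muleindic_ge0.
  under [RHS]eq_integral.
    move=> x xD; rewrite fimfunE -fsumEFin// muleC ge0_mule_fsumr; last first.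
      by move=> r; rewrite EFinM nnfun_muleindic_ge0.
    over.
  rewrite [RHS]ge0_integral_fsum//; last 2 first.
    - move=> r; apply: emeasurable_funM => //.
      by exact/measurable_EFinP/measurableT_comp.
    - by move=> r x _; rewrite EFinM mule_ge0// nnfun_muleindic_ge0.
  apply: eq_fsbigr => r rf.
  have r0 : (0 <= r)%R.
    by move: rf; rewrite inE => -[x _ <-].
  under eq_integral do rewrite EFinM.
  rewrite ge0_integralZl//; last exact/measurable_EFinP/measurable_indic.
  rewrite indicP// -ge0_integralZl//; last 2 first.
    - by apply: emeasurable_funM => //; exact/measurable_EFinP/measurable_indic.
    - by move=> x _; rewrite mule_ge0// lee_fin.
  by apply: eq_integral => x _; rewrite EFinM [in RHS]muleC -muleA.
transitivity (limn (fun n => \int[nu]_x (f_ n x)%:E)).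
  rewrite -monotone_convergence//=.
  - by apply: eq_integral => x _; apply/esym/cvg_lim => //; exact: cvg_nnsfun_approx.
  - by move=> n; exact/measurable_EFinP/measurable_funTS.
  - by move=> n ? _; rewrite lee_fin.
  - by move=> ? _ ? ? mn; rewrite lee_fin; exact/lefP/nd_nnsfun_approx.
under eq_fun do rewrite nnsfunP.
rewrite -monotone_convergence//=.
- apply: eq_integral => x _; apply/cvg_lim => //.
  by apply: cvgeZr => //; exact: cvg_nnsfun_approx.
- move=> n; apply: emeasurable_funM => //.
  by exact/measurable_EFinP/measurable_funTS.
- by move=> n x _; rewrite mule_ge0// lee_fin.
- move=> x _ a b ab; apply: lee_wpmul2r => //; rewrite lee_fin.
  exact/lefP/nd_nnsfun_approx.
Qed.

(** The translated measure also gives half-open intervals their length, and this characterizes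
    Lebesgue measure. *)
Lemma lebesgue_measure_shift (h : R) (A : set R) : measurable A ->
  mu ((fun x => x + h)%R @^-1` A) = mu A.
Proof.
move=> mA; apply/esym.
have mh : measurable_fun setT (fun x : measurableTypeR R => x + h : measurableTypeR R)%R.
  exact: measurable_funD.
pose m : {measure set (measurableTypeR R) -> \bar R} :=
  pushforward mu (fun x : R => x + h : measurableTypeR R)%R.
rewrite (_ : mu (_ @^-1` A) = m mh A)//; apply: lebesgue_measure_unique => // _ [[a b] _ <-].
rewrite /m/= /pushforward.
rewrite (_ : _ @^-1` _ = `](a - h)%R, (b - h)%R]%classic); last first.
  by apply/seteqP; split => x; rewrite /= !in_itv/= ltrBlDr lerBrDr.
by rewrite !lebesgue_measure_itv/= !lte_fin ltrD2r -!EFinB opprB addrA subrK.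
Qed.

Lemma ge0_integral_shift (h : R) (f : R -> \bar R) :
  measurable_fun setT f -> (forall x, 0 <= f x) ->
  \int[mu]_x f (x + h)%R = \int[mu]_x f x.
Proof.
move=> mf f0.
have mh : measurable_fun setT (fun x : measurableTypeR R => x + h : measurableTypeR R)%R.
  exact: measurable_funD.
have := ge0_integral_pushforward mh mu measurableT mf (fun x _ => f0 x).
rewrite preimage_setT => <-.
by apply: eq_measure_integral => A mA _; apply: lebesgue_measure_shift.
Qed.

(** The choice l = I / A is enough. The lemma serves both Cauchy-Schwarz below and the bound on
    signal increments. *)
Lemma sqr_le_of_amgm (I A B : R) : (0 <= I -> 0 <= A -> 0 <= B ->
  (forall l, 0 < l -> I *+ 2 <= l * A + l^-1 * B) -> I ^+ 2 <= A * B)%R.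
Proof.
move=> I0 A0 B0 amgm.
have [->|Ineq0] := eqVneq I 0%R; first by rewrite expr0n/= mulr_ge0.
have {Ineq0}I0 : (0 < I)%R by rewrite lt0r Ineq0.
have [A00|Aneq0] := eqVneq A 0%R.
  (* If A = 0, this l gives 2 I <= I B / (B + 1) <= I, which contradicts I > 0. *)
  have := amgm ((B + 1) / I)%R; rewrite A00 mulr0 add0r invf_div => h.
  have B1 : (0 < B + 1)%R by lra.
  have {}h := h (divr_gt0 B1 I0).
  suff : (I / (B + 1) * B <= I)%R by lra.
  by rewrite mulrAC ler_pdivrMr// ler_pM2l//; lra.
have {Aneq0}A0 : (0 < A)%R by rewrite lt0r Aneq0.
have := amgm (I / A)%R (divr_gt0 I0 A0); rewrite divfK ?gt_eqF// invf_div => h.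
have {}h : (I <= A / I * B)%R by lra.
by rewrite expr2 -ler_pdivlMr// mulrAC.
Qed.

(** Integrate 2 g L <= l g^2 + l^-1 L^2 and optimise l. Infinite values of g and of the integral of
    g^2 are allowed; B > 0 makes the right side infinite in the latter case. *)
Lemma cauchy_schwarz_ge0 d (T : measurableType d) (m : {measure set T -> \bar R})
    (g : T -> \bar R) (L : T -> R) :
  measurable_fun setT g -> (forall x, 0 <= g x) ->
  measurable_fun setT L -> (forall x, 0 <= L x)%R ->
  0 < \int[m]_x (L x ^+ 2)%:E -> \int[m]_x (L x ^+ 2)%:E < +oo ->
  (\int[m]_x (g x * (L x)%:E)) ^+ 2 <=
  (\int[m]_x (L x ^+ 2)%:E) * (\int[m]_x (g x ^+ 2)).
Proof.
move=> mg g0 mL L0 B0 Boo.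
set B := \int[m]_x _ in B0 Boo *; set A := \int[m]_x (g x ^+ 2).
set I := \int[m]_x _.
have mLE : measurable_fun setT (EFin \o L) by exact/measurable_EFinP.
have mL2 : measurable_fun setT (fun x => (L x ^+ 2)%:E).
  by apply/measurable_EFinP; exact: measurable_funX.
have mg2 := emeasurable_fun_sqr mg.
have A0 : 0 <= A by apply: integral_ge0 => x _; rewrite expe_ge0.
have I0 : 0 <= I by apply: integral_ge0 => x _; rewrite mule_ge0// lee_fin.
have [->|Aoo] := eqVneq A +oo; first by rewrite gt0_muley// leey.
have amgm (l : R) : (0 < l)%R -> 2%:E * I <= l%:E * A + l^-1%:E * B.
  move=> l0.
  have li0 : (0 <= l^-1)%R by rewrite invr_ge0 ltW.
  have l0' : (0 <= l)%R by exact: ltW.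
  have -> : 2%:E * I = \int[m]_x (2%:E * (g x * (L x)%:E)).
    rewrite ge0_integralZl//; first exact: emeasurable_funM.
    by move=> x _; rewrite mule_ge0// lee_fin.
  have -> : l%:E * A = \int[m]_x (l%:E * (g x ^+ 2)).
    by rewrite ge0_integralZl// => x _; rewrite expe_ge0.
  have -> : l^-1%:E * B = \int[m]_x (l^-1%:E * (L x ^+ 2)%:E).
    by rewrite ge0_integralZl// => x _; rewrite lee_fin sqr_ge0.
  rewrite -ge0_integralD//; last 4 first.
  - by move=> x _; rewrite mule_ge0 ?expe_ge0// lee_fin ltW.
  - exact: measurable_funeM.
  - by move=> x _; rewrite mule_ge0 ?expe_ge0// lee_fin ?sqr_ge0.
  - exact: measurable_funeM.
  apply: ge0_le_integral => //.
  - by move=> x _; rewrite !mule_ge0// lee_fin.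
  - by apply: measurable_funeM; exact: emeasurable_funM.
  - by apply: emeasurable_funD; exact: measurable_funeM.
  move=> x _; case: (g x) (g0 x) => [r||//]; last first.
    by rewrite expe2 mulyy gt0_muley ?lte_fin// addye ?leey.
  rewrite lee_fin => r0; rewrite expe2 -!EFinM -EFinD lee_fin.
    have := sqr_ge0 (l * r - L x)%R => h.
    rewrite -(ler_pM2l l0) mulrDr (mulrA l l^-1%R) divff ?gt_eqF// mul1r.
    by nra.
have Afin : A \is a fin_num by rewrite ge0_fin_numE// ltey.
have Bfin : B \is a fin_num by rewrite ge0_fin_numE// ltW.
(* Finiteness comes from the integrated bound at l = 1. *)
have Ifin : I \is a fin_num.
  rewrite ge0_fin_numE//.
  have : 2%:E * I < +oo.
    apply: le_lt_trans (amgm 1%R ltr01) _.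
    by rewrite invr1 !mul1e lte_add_pinfty// ltey_eq ?Afin ?Bfin.
  by case: (I) I0 => [r _ _|_|//]; [exact: ltry|rewrite gt0_muley ?lte_fin].
rewrite -(fineK Afin) -(fineK Bfin) -(fineK Ifin) -EFin_expe -EFinM lee_fin mulrC.
apply: sqr_le_of_amgm; [exact: fine_ge0|exact: fine_ge0|exact/fine_ge0/ltW|].
move=> l l0; have := amgm l l0.
by rewrite -(fineK Afin) -(fineK Bfin) -(fineK Ifin) -!EFinM -EFinD lee_fin mulr_natl.
Qed.

End integration.

(** * Shifts of a Gaussian law *)

Section gaussian.
Local Open Scope ereal_scope.
Context {R : realType}.
Notation mu := (@lebesgue_measure R).

Lemma ge0_integral_normal_prob (c s : R) (f : R -> \bar R) :
  measurable_fun setT f -> (forall x, 0 <= f x) ->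
  \int[normal_prob c s]_x f x = \int[mu]_x (f x * (normal_pdf c s x)%:E).
Proof.
move=> mf f0; apply: ge0_integral_density => //.
- exact: measurable_normal_pdf.
- exact: normal_pdf_ge0.
Qed.

(** Translation replaces the left integral by one of g against N(h, s^2); Cauchy-Schwarz then leaves
    the second moment of the likelihood ratio. *)
Lemma L2_dominated_normal_shift (h s : R) (g : R -> \bar R) : (s != 0)%R ->
  measurable_fun setT g -> (forall x, 0 <= g x) ->
  (\int[normal_prob 0 s]_x g (x + h)%R) ^+ 2 <=
  (expR (h ^+ 2 / s ^+ 2))%:E * \int[normal_prob 0 s]_x (g x ^+ 2).
Proof.
move=> s0 mg g0.
(* density of N(h, s^2) with respect to N(0, s^2) *)
pose L x : R := expR ((x * (h *+ 2) - h ^+ 2) / (s ^+ 2 *+ 2)).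
have mL : measurable_fun setT L.
  apply: measurableT_comp => //; apply: measurable_funM => //.
  by apply: measurable_funB => //; exact: measurable_funM.
have L0 x : (0 <= L x)%R by exact: expR_ge0.
have LE x : normal_pdf h s x = (L x * normal_pdf 0 s x)%R.
  rewrite !normal_pdfE// /normal_fun mulrCA -expRD; congr (_ * expR _)%R.
  by rewrite -mulrDl; congr (_ / _)%R; rewrite subr0; ring.
(* Completing the square shows a multiple of the N(2h, s^2) density, so the second moment of [L] is
   the prefactor. *)
have L2E x : (L x ^+ 2 * normal_pdf 0 s x = expR (h ^+ 2 / s ^+ 2) * normal_pdf (h *+ 2) s x)%R.
  rewrite !normal_pdfE// /normal_fun mulrCA [RHS]mulrCA; congr (_ * _)%R.
  rewrite -expRM_natl -!expRD; congr expR; rewrite subr0.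
  by field.
have mgh : measurable_fun setT (fun x : R => g (x + h)%R).
  by apply: measurableT_comp => //; exact: measurable_funD.
rewrite ge0_integral_normal_prob//.
have -> : \int[mu]_x (g (x + h)%R * (normal_pdf 0 s x)%:E) =
    \int[normal_prob 0 s]_x (g x * (L x)%:E).
  rewrite ge0_integral_normal_prob//; last 2 first.
  - by apply: emeasurable_funM => //; exact/measurable_EFinP.
  - by move=> x; rewrite mule_ge0// lee_fin.
  rewrite -[RHS](ge0_integral_shift h); last 2 first.
  - apply: emeasurable_funM.
      by apply: emeasurable_funM => //; exact/measurable_EFinP.
    by apply/measurable_EFinP; exact: measurable_normal_pdf.
  - by move=> x; rewrite !mule_ge0// lee_fin ?normal_pdf_ge0.
  apply: eq_integral => x _; rewrite -muleA -EFinM -LE; congr (_ * _%:E).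
  by rewrite !normal_pdfE// /normal_fun addrK subr0.
have BE : \int[normal_prob 0 s]_x (L x ^+ 2)%:E = (expR (h ^+ 2 / s ^+ 2))%:E.
  rewrite ge0_integral_normal_prob//; last 2 first.
  - by apply/measurable_EFinP; exact: measurable_funX.
  - by move=> x; rewrite lee_fin sqr_ge0.
  under eq_integral do rewrite -EFinM L2E EFinM.
  rewrite ge0_integralZl//; last 2 first.
  - by apply/measurable_EFinP; exact: measurable_normal_pdf.
  - by move=> x _; rewrite lee_fin normal_pdf_ge0.
  by rewrite integral_normal_pdf mule1.
rewrite -BE; apply: cauchy_schwarz_ge0 => //.
- by rewrite BE lte_fin expR_gt0.
- by rewrite BE ltry.
Qed.

End gaussian.

(** * Approximating a generated sigma-algebra by an algebra of sets *)

Section approximation.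
Local Open Scope ereal_scope.
Context {R : realType} d (T : measurableType d).
Variables (m : {measure set T -> \bar R}) (G : set (set T)).
Hypothesis m_fin : m setT < +oo.
Hypothesis G_meas : G `<=` measurable.
Hypothesis G0 : G set0.
Hypothesis GC : forall A, G A -> G (~` A).
Hypothesis GU : setU_closed G.

Let approx (A : set T) : Prop := measurable A /\
  forall e : R, (0 < e)%R -> exists2 A', G A' & m (A `+` A') <= e%:E.

Let measurableY (A B : set T) : measurable A -> measurable B -> measurable (A `+` B).
Proof. by move=> mA mB; apply: measurableU; exact: measurableD. Qed.

Let approxU A B : approx A -> approx B -> approx (A `|` B).
Proof.
move=> [mA aA] [mB aB]; split; first exact: measurableU.
move=> e e0; have e20 : (0 < e / 2)%R by rewrite divr_gt0.
have [A' GA' hA] := aA _ e20; have [B' GB' hB] := aB _ e20.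
exists (A' `|` B'); first exact: GU.
have mA' := G_meas GA'; have mB' := G_meas GB'.
apply: (@le_trans _ _ (m (A `+` A') + m (B `+` B'))); last first.
  by rewrite (splitr e) EFinD leeD.
apply: (le_trans _ (measureU2 _ _ _)); [|exact: measurableY..].
apply: le_measure; rewrite ?inE.
- by apply: measurableY; exact: measurableU.
- by apply: measurableU; exact: measurableY.
- by move=> x /=; tauto.
Qed.

(** The approximable sets form a sigma-algebra. Countable unions reduce to finite ones, because the
    finite measure m is continuous along the decreasing remainders. *)
Lemma sigma_algebra_approx A : <<s G >> A -> measurable A /\
  forall e : R, (0 < e)%R -> exists2 A', G A' & m (A `+` A') <= e%:E.
Proof.
suff : <<s G >> `<=` approx by move=> h /h.
apply: smallest_sub; last first.
  move=> B GB; split; first exact: G_meas.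
  by move=> e e0; exists B => //; rewrite setYK measure0 lee_fin ltW.
split.
- split=> // e e0; exists set0 => //.
  by rewrite setYK measure0 lee_fin ltW.
- move=> B [mB aB]; rewrite setTD; split; first exact: measurableC.
  move=> e e0; have [B' GB' hB] := aB _ e0; exists (~` B'); first exact: GC.
  rewrite (_ : _ `+` _ = B `+` B')//.
  apply/seteqP; split => x /=;
    by case: (pselect (B x)) => ?; case: (pselect (B' x)); tauto.
move=> F aF.
have mF i : measurable (F i) by have [] := aF i.
have mUF : measurable (\bigcup_k F k) by exact: bigcupT_measurable.
split=> // e e0; have e20 : (0 < e / 2)%R by rewrite divr_gt0.
pose U n := \big[setU/set0]_(i < n) F i.
have aU n : approx (U n).
  rewrite /U; elim: n => [|n IH]; last by rewrite big_ord_recr/=; exact: approxU.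
  rewrite big_ord0; split=> // e' e'0; exists set0 => //.
  by rewrite setYK measure0 lee_fin ltW.
have mU n : measurable (U n) by have [] := aU n.
have [n hn] : exists n, m ((\bigcup_k F k) `\` U n) <= (e / 2)%:E.
  pose D n := (\bigcup_k F k) `\` U n.
  have mD n : measurable (D n) by exact: measurableD.
  have D0 : \bigcap_n D n = set0.
    rewrite -subset0 => x Dx; have [[k _ Fkx] _] := Dx 0%N I.
    have [_] := Dx k.+1 I; apply; rewrite /U big_ord_recr/=; right; exact: Fkx.
  have : m \o D @ \oo --> m (\bigcap_n D n).
    apply: nonincreasing_cvg_mu => //.
    - by apply: le_lt_trans m_fin; apply: le_measure; rewrite ?inE.
    - by rewrite D0.
    - move=> i j ij; apply/subsetPset; apply: setDS.
      exact: subset_bigsetU.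
  rewrite D0 measure0 => /fine_cvgP[Dfin /cvgr0Pnorm_le /(_ _ e20) Dcvg].
  near \oo => n; exists n.
  have Dn : m (D n) \is a fin_num by near: n.
  rewrite -[leLHS](fineK Dn) lee_fin; apply: le_trans (ler_norm _) _.
  by near: n; exact: Dcvg.
have [_ /(_ _ e20)[A' GA' hA]] := aU n.
exists A' => //; have mA' := G_meas GA'.
apply: (@le_trans _ _ (m ((\bigcup_k F k) `\` U n) + m (U n `+` A'))); last first.
  by rewrite (splitr e) EFinD leeD.
apply: (le_trans _ (measureU2 _ _ _)); [|exact: measurableD|exact: measurableY].
apply: le_measure; rewrite ?inE.
- exact: measurableY.
- by apply: measurableU; [exact: measurableD|exact: measurableY].
- have sU : U n `<=` \bigcup_k F k by exact: bigsetU_bigcup.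
  move=> x /= [[Fx nA]|[Ax nF]].
    by have [Ux|nUx] := pselect (U n x); [right; left|left].
  by right; right; split => // /sU.
Unshelve. all: end_near. Qed.

End approximation.

(** * Finite time grids in [0,1] *)

Section grid.
Context {R : realType}.

(** The bounds concern all indices, also those past k, so that the Brownian increments are
    measurable for every i. *)
Definition grid (k : nat) (t : nat -> R) : Prop :=
  [/\ t 0%N = 0, (forall i, (i < k)%N -> t i < t i.+1) &
      forall i, 0 <= t i <= 1].

Lemma grid_ltn k t i j : grid k t -> (i < j)%N -> (j <= k)%N -> t i < t j.
Proof.
move=> [_ incr _]; elim: j => // j IH; rewrite ltnS leq_eqVlt => /predU1P[->|ij] jk.
  exact: incr.
by rewrite (lt_trans (IH ij (ltnW jk)))// incr.
Qed.

Lemma grid_le k t i j : grid k t -> (i <= k)%N -> (j <= k)%N ->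
  (t i <= t j) = (i <= j)%N.
Proof.
move=> gt ik jk; apply/idP/idP => [|].
  by apply: contraTT; rewrite -ltnNge -ltNge => ji; exact: (grid_ltn gt).
by rewrite leq_eqVlt => /predU1P[->//|ij]; apply/ltW/(grid_ltn gt).
Qed.

Lemma exists_grid (s : seq R) : exists k t, grid k t /\
  forall x, x \in s -> 0 <= x <= 1 -> exists2 j, (j <= k)%N & x = t j.
Proof.
pose l := sort <=%R (undup (0 :: [seq x <- s | 0 <= x <= 1])).
have lE x : (x \in l) = (x == 0) || ((0 <= x <= 1) && (x \in s)).
  by rewrite mem_sort mem_undup inE mem_filter.
have l01 x : x \in l -> 0 <= x <= 1.
  by rewrite lE => /orP[/eqP->|/andP[]//]; rewrite lexx ler01.
have sl : sorted <%R l by rewrite sort_lt_sorted undup_uniq.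
have l0 : (0 < size l)%N by have : 0 \in l; [rewrite lE eqxx|case: (l)].
(* A grid with k steps has k + 1 points; past the end [nth] returns its default 0, which stays in
   [0,1]. *)
exists (size l).-1, (nth 0 l); split; last first.
  move=> x xs x01; have xl : x \in l by rewrite lE x01 xs orbT.
  exists (index x l); last by rewrite nth_index.
  by rewrite -ltnS prednK// index_mem.
have lt_nth i j : (i < j)%N -> (j < size l)%N -> nth 0 l i < nth 0 l j.
  move=> ij jl; apply: (sorted_ltn_nth lt_trans) => //; rewrite inE//.
  exact: ltn_trans jl.
split.
(* If 0 sat at a positive index, the first entry would be negative. *)
- have /(nthP 0)[[//|i] il l_i0] : 0 \in l by rewrite lE eqxx.
  have := lt_nth 0%N i.+1 isT il; rewrite l_i0 ltNge.
  by have /l01/andP[->] := mem_nth 0 l0.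
- move=> i il; apply: lt_nth => //; by rewrite -(prednK l0) ltnS.
- move=> i; have [il|il] := ltnP i (size l); first exact/l01/mem_nth.
  by rewrite nth_default// lexx ler01.
Qed.

(** The range of summation is a condition on times, not on indices, so that the same formula defines
    a path at every real argument. *)
Lemma grid_telescope k t j (V : R -> R) : grid k t -> (j <= k)%N ->
  \sum_(i < k | t i.+1 <= t j) (V (t i.+1) - V (t i)) = V (t j) - V (t 0%N).
Proof.
move=> gt jk.
transitivity (\sum_(0 <= i < j) (V (t i.+1) - V (t i))); last first.
  by rewrite telescope_sumr.
rewrite [RHS](big_nat_widen _ _ k)// big_mkord; apply: eq_bigl => i.
by rewrite (grid_le gt)//= ltn_ord.
Qed.

End grid.

(** * Events that read a path at finitely many times *)

Section finite_events.
Context {R : realType}.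

Definition cylinders_at (s : seq R) : set (set (R -> R)) :=
  [set A | exists t (B : set R),
    [/\ t \in s, 0 <= t <= 1, measurable B & A = [set y | B (y t)]]].

Definition finite_events : set (set (R -> R)) :=
  [set A | exists s, <<s cylinders_at s >> A].

Lemma cylinders_at_sub s s' : {subset s <= s'} ->
  <<s cylinders_at s >> `<=` <<s cylinders_at s' >>.
Proof.
move=> ss'; apply: sub_sigma_algebra2 => _ [t [B [ts t01 mB ->]]].
by exists t, B; split => //; exact: ss'.
Qed.

Lemma finite_events0 : finite_events set0.
Proof. by exists [::]; exact: sigma_algebra0. Qed.

Lemma finite_eventsC A : finite_events A -> finite_events (~` A).
Proof. by move=> [s As]; exists s; rewrite -setTD; exact: sigma_algebraCD. Qed.

Lemma finite_eventsU : setU_closed finite_events.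
Proof.
move=> A B [s As] [s' Bs']; exists (s ++ s').
pose F i := if i == 0%N then A else B.
have -> : A `|` B = \bigcup_i F i.
  apply/seteqP; split => [y [Ay|By]|y [i _]].
  - by exists 0%N.
  - by exists 1%N.
  - by rewrite /F; case: ifP; [left|right].
apply: sigma_algebra_bigcup => i; rewrite /F; case: ifP => _.
- by apply: cylinders_at_sub As => x xs; rewrite mem_cat xs.
- by apply: cylinders_at_sub Bs' => x xs; rewrite mem_cat xs orbT.
Qed.

Lemma finite_events_measurable : finite_events `<=` <<s @path_cylinders R >>.
Proof.
move=> A [s]; apply: smallest_sub => // _ [t [B [_ t01 mB ->]]].
by apply: sub_sigma_algebra; exists t, B.
Qed.

Lemma path_cylinders_sub : <<s @path_cylinders R >> `<=` <<s finite_events >>.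
Proof.
apply: sub_sigma_algebra2 => _ [t [B [t01 [mB ->]]]].
exists [:: t]; apply: sub_sigma_algebra; exists t, B; split => //.
by rewrite inE.
Qed.

End finite_events.

(** * Increments of Brownian motion, with and without a shift *)

Section brownian_motion.
Context {R : realType} d (Omega : measurableType d) (P : probability Omega R).
Variable W : R -> Omega -> R.
Hypothesis BM : is_std_BM P W.

Lemma BM_increment (s t : R) (B : set R) : 0 <= s -> s < t -> t <= 1 ->
  measurable B ->
  P [set w | B (W t w - W s w)] = normal_prob 0 (Num.sqrt (t - s)) B.
Proof.
case: BM => _ _ _ ind s0 st t1 mB.
have := ind 1%N (fun i => if i == 0%N then s else t) (fun=> B) s0.
rewrite big_ord1/= => <- //; last by case.
congr (P _); apply/seteqP; split => [w Bw [|//] _|w /(_ 0%N)] //.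
by apply.
Qed.

Variables (k : nat) (t : nat -> R).
Hypothesis gt : grid k t.
Variable theta : nat -> R.

Definition increment (i : nat) (w : Omega) : R := W (t i.+1) w - W (t i) w.

Lemma measurable_increment i : measurable_fun setT (increment i).
Proof.
case: BM => mW _ _ _; case: gt => _ _ t01.
by apply: measurable_funB; exact: mW.
Qed.

Lemma independent_increments : independent_upto P k increment.
Proof.
case: BM => _ _ _ ind; case: (gt) => t0 incr t01 m mk B mB.
rewrite /increment ind//.
- apply: eq_bigr => i _; have ik := leq_trans (ltn_ord i) mk.
  rewrite -BM_increment//; last 2 first.
  + exact: incr.
  + by have /andP[] := t01 i.+1.
  by have /andP[] := t01 i.
- by rewrite t0.
- by move=> i im; apply/incr/(leq_trans im).
- by have /andP[] := t01 m.
Qed.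

Lemma measurable_shifted_increment i :
  measurable_fun setT (fun w => increment i w + theta i).
Proof. by apply: measurable_funD => //; exact: measurable_increment. Qed.

Lemma independent_shifted_increments :
  independent_upto P k (fun i w => increment i w + theta i).
Proof.
move=> m mk B mB.
pose C i := (fun x => x + theta i) @^-1` B i.
apply: (independent_increments mk (B := C)) => i.
by rewrite -[X in measurable X]setTI; apply: measurable_funD.
Qed.

(** The increment is centred Gaussian with variance t i.+1 - t i, so the Gaussian shift bound
    applies with h = [theta i]. *)
Lemma L2_dominated_increment i : (i < k)%N ->
  L2_dominated (distribution P (mfun_of (measurable_shifted_increment i)))
               (distribution P (mfun_of (measurable_increment i)))
               (expR (theta i ^+ 2 / (t i.+1 - t i))).
Proof.
case: (gt) => t0 incr t01 ik g mg g0.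
have dt : 0 < t i.+1 - t i by rewrite subr_gt0 incr.
have mX : measurable_fun setT (increment i : Omega -> measurableTypeR R).
  exact: measurable_increment.
have lawE (h : R -> \bar R) : measurable_fun setT h -> (forall x, 0 <= h x)%E ->
   (\int[distribution P (mfun_of (measurable_increment i))]_x h x =
   \int[normal_prob 0 (Num.sqrt (t i.+1 - t i))]_x h x)%E.
  move=> mh h0; rewrite ge0_integral_distribution//.
  rewrite -[LHS](@ge0_integral_distribution _ _ _ _ _ P (mfun_of mX) h)//.
  apply: eq_measure_integral => A mA _.
  have ti : 0 <= t i by have /andP[] := t01 i.
  have ti1 : t i.+1 <= 1 by have /andP[] := t01 i.+1.
  exact (BM_increment ti (incr i ik) ti1 mA).
have mgh : measurable_fun setT (fun x : R => g (x + theta i)).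
  by apply: measurableT_comp => //; exact: measurable_funD.
have -> : (\int[distribution P (mfun_of (measurable_shifted_increment i))]_x g x =
  \int[normal_prob 0 (Num.sqrt (t i.+1 - t i))]_x g (x + theta i)%R)%E.
  by rewrite -lawE// !ge0_integral_distribution.
rewrite lawE; last 2 first.
- exact: emeasurable_fun_sqr.
- by move=> x; rewrite expe_ge0.
have sg0 : Num.sqrt (t i.+1 - t i) != 0 by rewrite gt_eqF// sqrtr_gt0.
by have := L2_dominated_normal_shift (theta i) sg0 mg g0; rewrite (sqr_sqrtr (ltW dt)).
Qed.

End brownian_motion.

(** * Comparison of two signals observed in the same noise *)

Section shifted_brownian_motion.
Local Open Scope ereal_scope.
Context {R : realType} d (Omega : measurableType d) (P : probability Omega R).
Variable W : R -> Omega -> R.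
Hypothesis BM : is_std_BM P W.
Variables (c : R) (F0 F1 Q : R -> R).
Hypothesis c0 : (c != 0)%R.
Hypothesis F01 : F0 0%R = F1 0%R.
(** This is Cauchy-Schwarz on [s, t] when Q is a primitive of a bound on the squared derivative of
    (F1 - F0) / c. Divided by t - s, the right side telescopes along any grid. *)
Hypothesis FQ : (forall s t, 0 <= s -> s < t -> t <= 1 ->
  (((F1 t - F0 t) - (F1 s - F0 s)) / c) ^+ 2 <= (t - s) * (Q t - Q s))%R.

Definition signal_path (F : R -> R) (w : Omega) : R -> R :=
  fun x => (F x + c * W x w)%R.

Let Q_mono s t : (0 <= s -> s <= t -> t <= 1 -> Q s <= Q t)%R.
Proof.
move=> s0; rewrite le_eqVlt => /predU1P[->//|st] t1.
rewrite -subr_ge0 -(@pmulr_rge0 _ (t - s)%R) ?subr_gt0//.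
by apply: le_trans (FQ s0 st t1); exact: sqr_ge0.
Qed.

Lemma measurable_signal_path F : measurable_fun setT
  (signal_path F : Omega -> g_sigma_algebraType (@path_cylinders R)).
Proof.
case: BM => mW _ _ _.
apply: (@measurability _ _ Omega (g_sigma_algebraType (@path_cylinders R)) setT
  _ (@path_cylinders R)) => //.
move=> _ [_ [t [B [t01 [mB ->]]]] <-].
have mY : measurable_fun setT (fun w => F t + c * W t w)%R.
  by apply: measurable_funD => //; apply: measurable_funM => //; exact: mW.
exact: mY.
Qed.

(** On a grid through the times read by A, both paths come from one measurable map [Psi], fed with
    Brownian increments for F0 and with shifted ones for F1. The domination of the increments is
    applied to the indicator of the preimage of A, which is its own square. *)
Lemma finite_event_bound A : finite_events A ->
  (P (signal_path F1 @^-1` A)) ^+ 2 <=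
  (expR (Q 1 - Q 0))%:E * P (signal_path F0 @^-1` A).
Proof.
case: (BM) => mW W0 _ _ [s As].
have [k [t [gt ts]]] := exists_grid s.
case: (gt) => t0 incr t01.
(* F1 + c W = F0 + c (W + H): changing the signal amounts to shifting the increments of W by those
   of [H]. *)
pose H x := ((F1 x - F0 x) / c)%R.
pose theta i := (H (t i.+1) - H (t i))%R.
pose Psi (u : coord_space k) : R -> R :=
  fun x => (F0 x + c * \sum_(i < k | (t i.+1 <= x)%R) u i)%R.
have mPsi : measurable_fun setT
    (Psi : coord_space k -> g_sigma_algebraType (cylinders_at s)).
  apply: (@measurability _ _ (coord_space k) (g_sigma_algebraType (cylinders_at s)) setT
    _ (cylinders_at s)) => //.
  move=> _ [_ [x [B [xs x01 mB ->]]] <-].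
  have mY : measurable_fun setT (fun u : coord_space k => Psi u x).
    apply: measurable_funD => //; apply: measurable_funM => //.
    rewrite (_ : (fun u : coord_space k => _) = (fun u : coord_space k =>
      \sum_(i < k) (if (t i.+1 <= x)%R then u i else 0%R))%R); last first.
      by apply/funext => u; rewrite big_mkcond.
    apply: (@measurable_sum _ (coord_space k) R setT 'I_k _ (fun (i : 'I_k) u =>
      if (t i.+1 <= x)%R then u i else 0%R)) => i.
    by case: (t i.+1 <= x)%R; [exact: coord_measurable|exact: measurable_cst].
  exact: mY.
(* [Psi] rebuilds the path at grid points only; this suffices because A does not separate paths that
   agree at the times of s in [0,1]. *)
pose e (y z : R -> R) := forall x, x \in s -> (0 <= x <= 1)%R -> y x = z x.
have inv y z : e y z -> (A y <-> A z).
  suff inv0 B : cylinders_at s B -> forall y z, e y z -> (B y <-> B z).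
    exact: (sigma_algebra_invariant inv0 As).
  by move=> [x [C [xs x01 mC ->]]] y' z' eyz /=; rewrite (eyz x).
pose X0 i w := increment W t i w.
pose X1 i w := (increment W t i w + theta i)%R.
have PsiE (u : nat -> R) (V : R -> R) x :
    (forall i, u i = V (t i.+1) - V (t i))%R -> V 0%R = 0%R ->
    x \in s -> (0 <= x <= 1)%R -> Psi u x = (F0 x + c * V x)%R.
  move=> uE V0 xs x01; have [j jk ->] := ts x xs x01; rewrite /Psi.
  under eq_bigr do rewrite uE.
  by rewrite (grid_telescope _ gt)// t0 V0 subr0.
have A0 w : A (signal_path F0 w) <-> A (Psi (X0^~ w)).
  apply: inv => x xs x01; rewrite (PsiE _ (fun x => W x w))//.
have A1 w : A (signal_path F1 w) <-> A (Psi (X1^~ w)).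
  apply: inv => x xs x01; rewrite (PsiE _ (fun x => W x w + H x)%R)//.
  - rewrite /signal_path mulrDr /H mulrCA divff// mulr1; ring.
  - by move=> i; rewrite /X1 /increment /theta; ring.
  - by rewrite W0 /H F01 subrr mul0r addr0.
have mE : measurable (Psi @^-1` A : set (coord_space k)).
  by rewrite -[X in measurable X]setTI; exact: mPsi.
have dom : L2_dominated
    (distribution P (mfun_of (measurable_tuple_of (k := k)
       (measurable_shifted_increment BM gt theta))))
    (distribution P (mfun_of (measurable_tuple_of (k := k)
       (measurable_increment BM gt))))
    (\prod_(i < k) expR (theta i ^+ 2 / (t i.+1 - t i))%R).
  apply: (L2_dominated_independent (a := fun i => expR (theta i ^+ 2 / (t i.+1 - t i))%R)).
  - exact: independent_shifted_increments.
  - exact: independent_increments.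
  - by move=> i; exact: expR_ge0.
  - by move=> i ik; exact: L2_dominated_increment.
have mI : measurable_fun setT (fun u : coord_space k => (\1_(Psi @^-1` A) u)%:E : \bar R).
  exact/measurable_EFinP/measurable_indic.
have I0 u : 0 <= (\1_(Psi @^-1` A) u)%:E :> \bar R by rewrite lee_fin.
have sqE u : ((\1_(Psi @^-1` A) u)%:E ^+ 2 = (\1_(Psi @^-1` A) u)%:E :> \bar R).
  by rewrite indicE; case: (_ \in _); rewrite ?expe2 ?mule1 ?mule0.
have := dom _ mI I0.
under [X in _ <= _ * X]eq_integral do rewrite sqE.
rewrite !integral_indic//= !setIT => h.
have -> : signal_path F1 @^-1` A = (fun w => X1^~ w) @^-1` (Psi @^-1` A).
  by apply/seteqP; split => w /A1.
have -> : signal_path F0 @^-1` A = (fun w => X0^~ w) @^-1` (Psi @^-1` A).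
  by apply/seteqP; split => w /A0.
apply: le_trans h _.
apply: lee_wpmul2r => //.
rewrite lee_fin -expR_sum ler_expR.
(* The last grid point may lie before 1, hence the use of the monotonicity of Q. *)
apply: (@le_trans _ _ (Q (t k) - Q (t 0%N))%R); last first.
  rewrite t0 lerB// Q_mono//; by have /andP[] := t01 k.
rewrite -(telescope_sumr (fun i => Q (t i))) // big_mkord.
apply: ler_sum => i _; have ti := incr i (ltn_ord i).
rewrite ler_pdivrMr ?subr_gt0// mulrC /theta /H -mulrBl.
apply: FQ => //; [by have /andP[] := t01 i|by have /andP[] := t01 i.+1].
Qed.

(** If both errors of the test A were below 1/8, a finite event A' close to A would have both errors
    below 1/4, against [finite_event_bound]. *)
Lemma testing_bound A : (expR (Q 1 - Q 0) <= 2)%R -> <<s @path_cylinders R >> A ->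
  (8^-1)%:E <= P (signal_path F0 @^-1` A) \/
  (8^-1)%:E <= P (signal_path F1 @^-1` (~` A)).
Proof.
move=> expQ sA.
pose Y F := mfun_of (measurable_signal_path F).
(* With the sum of the two laws, a single A' is within 1/8 of A under both. *)
pose m : {measure set (g_sigma_algebraType (@path_cylinders R)) -> \bar R} :=
  measure_add (distribution P (Y F0)) (distribution P (Y F1)).
have mE B : m B = P (signal_path F0 @^-1` B) + P (signal_path F1 @^-1` B).
  exact: measure_addE.
have [||||||mA /(_ 8^-1%R)[|A' GA' AA']] :=
  @sigma_algebra_approx R _ (g_sigma_algebraType (@path_cylinders R)) m finite_events
    _ _ _ _ _ A _.
- by rewrite mE !preimage_setT probability_setT ltry.
- exact: finite_events_measurable.
- exact: finite_events0.
- exact: finite_eventsC.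
- exact: finite_eventsU.
- exact: path_cylinders_sub.
- by rewrite invr_gt0.
have mA' : measurable (A' : set (g_sigma_algebraType (@path_cylinders R))).
  exact: finite_events_measurable.
have mYF F (B : set (g_sigma_algebraType (@path_cylinders R))) :
    measurable B -> measurable (signal_path F @^-1` B).
  by move=> mB; rewrite -[X in measurable X]setTI; exact: measurable_signal_path.
pose D : set (g_sigma_algebraType (@path_cylinders R)) := A `+` A'.
have mD : measurable D by apply: measurableU; exact: measurableD.
have D0 : P (signal_path F0 @^-1` D) <= 8^-1%:E.
  by apply: le_trans AA'; rewrite mE leeDl.
have D1 : P (signal_path F1 @^-1` D) <= 8^-1%:E.
  by apply: le_trans AA'; rewrite mE leeDr.
apply/orP; rewrite -implyNb; apply/implyP; rewrite -ltNge => A0.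
rewrite leNgt; apply/negP => A1.
have sub F (B C : set (g_sigma_algebraType (@path_cylinders R))) :
    measurable B -> measurable C -> C `<=` B `|` D ->
    P (signal_path F @^-1` C) <=
    P (signal_path F @^-1` B) + P (signal_path F @^-1` D).
  move=> mB mC CBD.
  apply: (le_trans _ (measureU2 _ _ _)); [|exact: mYF..].
  apply: le_measure; rewrite ?inE; [exact: mYF| |by move=> w /CBD].
  by apply: measurableU; exact: mYF.
have A'0 : P (signal_path F0 @^-1` A') < 4^-1%:E.
  apply: (le_lt_trans (sub F0 A A' mA mA' _)).
    by move=> y A'y; have [?|?] := pselect (A y); [left|right; right].
  rewrite (_ : 4^-1 = 8^-1 + 8^-1)%R; last by lra.
  by rewrite EFinD lte_leD// fin_num_measure//; exact: mYF.
have A'1 : P (signal_path F1 @^-1` ~` A') < 4^-1%:E.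
  apply: (le_lt_trans (sub F1 (~` A) (~` A') _ _ _)); [exact: measurableC..| |].
    by move=> y A'y; have [?|?] := pselect (A y); [right; left|left].
  rewrite (_ : 4^-1 = 8^-1 + 8^-1)%R; last by lra.
  by rewrite EFinD lte_leD// fin_num_measure//; exact: mYF.
have := finite_event_bound GA'.
have fin F : P (signal_path F @^-1` A') \is a fin_num.
  by rewrite fin_num_measure//; exact: mYF.
move: A'1; rewrite preimage_setC probability_setC; last exact: mYF.
move: A'0; rewrite -(fineK (fin F0)) -(fineK (fin F1)).
set p0 := fine _; set p1 := fine _.
rewrite -EFinB -EFin_expe -EFinM !lte_fin lee_fin => h0 h1 h.
have p00 : (0 <= p0)%R by rewrite fine_ge0.
(* The contradiction is 9/16 < p1^2 <= 2 p0 < 1/2. *)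
have : (expR (Q 1 - Q 0) * p0 <= 2 * p0)%R by rewrite ler_wpM2r.
nra.
Qed.

End shifted_brownian_motion.

(** * The two signals and the increments of their difference *)

Section signals.
Context {R : realType}.
Notation mu := (@lebesgue_measure R).

(** The drift of the observation for f(x) = x + b. *)
Definition signal (b t : R) : R :=
  Rintegral mu `[0, t] (fun s => 2 * Num.sqrt (s + b)).

Lemma signal0 b : signal b 0 = 0.
Proof. by rewrite /signal set_itv1 Rintegral_set1. Qed.

Lemma continuous_sqrtD b : continuous (fun s : R => 2 * Num.sqrt (s + b)).
Proof.
move=> x; apply: cvgM; first exact: cvg_cst.
apply: (@continuous_comp _ _ _ (fun s : R => s + b) Num.sqrt).
  by apply: cvgD; [exact: cvg_id|exact: cvg_cst].
exact: sqrt_continuous.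
Qed.

Lemma integrable_sqrtD b u v :
  mu.-integrable `[u, v] (EFin \o (fun s : R => 2 * Num.sqrt (s + b))).
Proof.
apply: continuous_compact_integrable; first exact: segment_compact.
exact/continuous_subspaceT/continuous_sqrtD.
Qed.

(** The integrand is the pointwise bound of [sqrtD_diff_bound]. Its primitive is explicit, as x + b
    stays positive on [s, t]. *)
Lemma integral_amgm_bound (b l s t : R) : 0 < b -> 0 <= s -> s < t ->
  Rintegral mu `[s, t] (fun x => b * (l + l^-1 * (x + b)^-1)) =
  b * (l * (t - s) + l^-1 * (ln (t + b) - ln (s + b))) /\
  mu.-integrable `[s, t] (EFin \o (fun x => b * (l + l^-1 * (x + b)^-1))).
Proof.
move=> b0 s0 st.
pose F (x : R) := b * (l * x + l^-1 * ln (x + b)).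
pose f (x : R) := b * (l + l^-1 * (x + b)^-1).
have pos x : s <= x -> 0 < x + b by move=> sx; lra.
have dF x : s <= x -> is_derive x (1 : R) F (f x).
  move=> sx; have xb := pos x sx.
  have dln : is_derive x (1 : R) (fun y : R => ln (y + b)) ((x + b)^-1).
    have := @is_derive1_comp R (@ln R) (fun y => y + b) x (x + b)^-1 1.
    rewrite mulr1; apply; first exact: is_derive1_ln.
    by apply: is_derive_eq; rewrite addr0.
  by rewrite /F /f; apply: is_derive_eq; rewrite /GRing.scale/=; ring.
have cf x : s <= x -> {for x, continuous f}.
  move=> sx; apply: cvgM; first exact: cvg_cst.
  apply: cvgD; first exact: cvg_cst.
  apply: cvgM; first exact: cvg_cst.
  apply: cvgV; first by rewrite gt_eqF// pos.
  by apply: cvgD; [exact: cvg_id|exact: cvg_cst].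
have cF x : s <= x -> {for x, continuous F}.
  move=> sx; apply: differentiable_continuous; apply/derivable1_diffP.
  by case: (dF x sx).
have cfst : {within `[s, t], continuous f}.
  apply/(continuous_within_itvP _ st); split.
  - by move=> x; rewrite in_itv/= => /andP[/ltW sx _]; exact: cf.
  - exact/cvg_at_right_filter/cf.
  - exact/cvg_at_left_filter/cf/ltW.
split; last first.
  by apply: continuous_compact_integrable; [exact: segment_compact|].
rewrite /Rintegral (@continuous_FTC2 _ f F s t st cfst).
- by rewrite -EFinB/= /F; ring.
- split.
  + move=> x; rewrite in_itv/= => /andP[/ltW sx _].
    by case: (dF x sx).
  + exact/cvg_at_right_filter/cF.
  + exact/cvg_at_left_filter/cF/ltW.
- move=> x; rewrite in_itv/= => /andP[/ltW sx _].
  by rewrite derive1E; case: (dF x sx).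
Qed.

Lemma signal_increment b s t : 0 <= s -> s < t ->
  signal b t - signal b s =
  Rintegral mu `[s, t] (fun x => 2 * Num.sqrt (x + b)).
Proof.
move=> s0 st; rewrite /signal Rintegral_itvB; last 3 first.
- exact: integrable_sqrtD.
- by rewrite bnd_simp.
- by rewrite bnd_simp ltW.
apply: Rintegral_itv_obnd_cbnd.
apply: integrableS (integrable_sqrtD b s t) => //.
exact: subset_itv_oc_cc.
Qed.

(** With p = sqrt (x + b) and q = sqrt x, 2 (p - q) = 2 b / (p + q) <= 2 b / p, and 2 / p <= l +
    l^-1 / p^2 by AM-GM. *)
Lemma sqrtD_diff_bound (b l x : R) : 0 < b -> 0 < l -> 0 <= x ->
  0 <= 2 * Num.sqrt (x + b) - 2 * Num.sqrt (x + 0) <= b * (l + l^-1 * (x + b)^-1).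
Proof.
move=> b0 l0 x0; rewrite addr0.
set p := Num.sqrt (x + b); set q := Num.sqrt x.
have p0 : 0 < p by rewrite sqrtr_gt0; lra.
have q0 : 0 <= q by exact: sqrtr_ge0.
have p2 : p ^+ 2 = x + b by rewrite sqr_sqrtr//; lra.
have q2 : q ^+ 2 = x by rewrite sqr_sqrtr.
have pq : q <= p by rewrite ler_sqrt; lra.
apply/andP; split; first by lra.
rewrite -p2.
have bE : b = (p - q) * (p + q) by nra.
rewrite -(ler_pM2r (mulr_gt0 l0 (exprn_gt0 2 p0))).
have -> : b * (l + l^-1 * (p ^+ 2)^-1) * (l * p ^+ 2) =
   b * (l ^+ 2 * p ^+ 2 + 1) by field; rewrite !gt_eqF.
rewrite bE.
(* Once denominators are cleared, right side minus left side is the sum of the terms in [h1] and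
   [h2]. *)
have h1 : 0 <= (p - q) * ((l * p - 1) ^+ 2 * p) .
  by rewrite mulr_ge0 ?subr_ge0// mulr_ge0 ?sqr_ge0// ltW.
have h2 : 0 <= (p - q) * (q * (l ^+ 2 * p ^+ 2 + 1)).
  by rewrite mulr_ge0 ?subr_ge0// mulr_ge0// addr_ge0// mulr_ge0// sqr_ge0.
by nra.
Qed.

(** Integrate [sqrtD_diff_bound] for each l, then optimise l; the logarithms are the integral of 1 /
    (x + b). *)
Lemma signal_diff_bound b s t : 0 < b -> 0 <= s -> s < t ->
  ((signal b t - signal 0 t) - (signal b s - signal 0 s)) ^+ 2 <=
  (t - s) * (4 * b ^+ 2 * (ln (t + b) - ln (s + b))).
Proof.
move=> b0 s0 st.
pose J := Rintegral mu `[s, t] (fun x => 2 * Num.sqrt (x + b) - 2 * Num.sqrt (x + 0)).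
have -> : signal b t - signal 0 t - (signal b s - signal 0 s) = J.
  rewrite /J RintegralB//; [|exact: integrable_sqrtD..].
  by rewrite -!signal_increment//; ring.
have iJ : mu.-integrable `[s, t]
    (EFin \o (fun x => 2 * Num.sqrt (x + b) - 2 * Num.sqrt (x + 0))).
  apply: continuous_compact_integrable; first exact: segment_compact.
  by apply: continuous_subspaceT => x; apply: cvgB; exact: continuous_sqrtD.
have J0 : 0 <= J.
  apply: Rintegral_ge0 => x /=; rewrite in_itv/= => /andP[sx _].
  by have /andP[] := sqrtD_diff_bound b0 ltr01 (le_trans s0 sx).
(* Dividing J by 2 b gives the integrated bound the shape 2 I <= l A + l^-1 B. *)
have JE : J ^+ 2 = 4 * b ^+ 2 * (J / (2 * b)) ^+ 2.
  by field; rewrite gt_eqF.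
rewrite JE [leRHS]mulrCA ler_pM2l ?mulr_gt0 ?exprn_gt0//.
apply: sqr_le_of_amgm.
- by rewrite divr_ge0// mulr_ge0// ltW.
- by rewrite subr_ge0 ltW.
- by rewrite subr_ge0 ler_ln ?posrE; lra.
move=> l l0; have [iE iI] := integral_amgm_bound l b0 s0 st.
have : J <= b * (l * (t - s) + l^-1 * (ln (t + b) - ln (s + b))).
  rewrite -iE; apply: le_Rintegral => //.
  move=> x /=; rewrite in_itv/= => /andP[sx _].
  by have /andP[] := sqrtD_diff_bound b0 l0 (le_trans s0 sx).
have -> : J / (2 * b) *+ 2 = J / b by field; rewrite gt_eqF.
by rewrite ler_pdivrMr// mulrC.
Qed.
End signals.

(** * Choice of the gap between the two values at 0 *)

Section calibration.
Context {R : realType} (n : nat).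
Hypothesis n5 : (5 <= n)%N.

Let N : R := n%:R.
Let r : R := Num.sqrt (N * ln N).
(** The factor 1/4 is twice the error threshold 1/8, and is small enough for the likelihood
    bound. *)
Let b : R := 4^-1 / r.

Let N5 : 5 <= N. Proof. by rewrite /N (ler_nat _ 5). Qed.

Let N0 : 0 < N. Proof. exact: lt_le_trans N5. Qed.

Let lnN : 2^-1 <= ln N.
Proof.
(* This is ln y <= y - 1 at y = 1 / N, which gives ln N >= 1 - 1 / N. *)
have h : ln (1 + (N^-1 - 1)) <= N^-1 - 1.
  by apply: le_ln1Dx; have : 0 < N^-1 by [rewrite invr_gt0]; lra.
have : N^-1 <= 2^-1 by rewrite lef_pV2 ?posrE//; have := N5; lra.
by move: h; rewrite addrC subrK lnV ?posrE//; lra.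
Qed.

Let r0 : 0 < r.
Proof. by rewrite sqrtr_gt0 mulr_gt0//; have := lnN; lra. Qed.

Let r2 : r ^+ 2 = N * ln N.
Proof. by rewrite sqr_sqrtr// mulr_ge0 ?ltW//; have := lnN; lra. Qed.

Let rN : r <= N.
Proof.
rewrite -(@ler_pXn2r _ 2) ?nnegrE; [|by []|exact: ltW..].
by rewrite r2 expr2 ler_pM2l//; exact/ltW/ln_sublinear.
Qed.

Lemma gap_gt0 : 0 < b. Proof. by rewrite divr_gt0. Qed.

(** This places x + b under the constraint on f(0); it amounts to N <= 16 N ln N. *)
Lemma gap_le : b <= (Num.sqrt N)^-1.
Proof.
have r4 : 0 < 4 * r by rewrite mulr_gt0.
rewrite /b -invfM lef_pV2 ?posrE//; last by rewrite sqrtr_gt0.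
rewrite -(@ler_pXn2r _ 2) ?nnegrE ?sqrtr_ge0//; last exact: ltW.
rewrite exprMn r2 sqr_sqrtr; last exact: ltW.
by have := lnN; have := N0; nra.
Qed.

Lemma gap_le1 : b <= 1.
Proof.
apply: le_trans gap_le _; rewrite invf_le1 ?sqrtr_gt0//.
by rewrite -[leLHS]sqrtr1 ler_sqrt; have := N5; lra.
Qed.

(** The exponent is ln (1 + 4 r) / (4 ln N), and 1 + 4 r <= 1 + 4 N <= N^2 bounds it by 1/2. The
    last inequality is where n >= 5 enters: it fails at 4. *)
Lemma likelihood_bound : expR (4 * b ^+ 2 * N * (ln (1 + b) - ln (0 + b))) <= 2.
Proof.
have b0 := gap_gt0; have ln0 : 0 < ln N by have := lnN; lra.
have -> : 4 * b ^+ 2 * N = (4 * ln N)^-1.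
  rewrite /b expr_div_n r2; field.
  by rewrite !gt_eqF.
have -> : ln (1 + b) - ln (0 + b) = ln (1 + 4 * r).
  rewrite add0r -ln_div ?posrE//; last by lra.
  congr ln; rewrite /b; field.
  by rewrite !gt_eqF.
have : ln (1 + 4 * r) <= ln (N ^+ 2).
  rewrite ler_ln ?posrE ?exprn_gt0//; last by have := r0; lra.
  by have := rN; have := N5; nra.
rewrite lnXn// => h.
apply: (@le_trans _ _ (expR 2^-1)).
  rewrite ler_expR mulrC ler_pdivrMr ?mulr_gt0//.
  by move: h; rewrite -mulr_natl; lra.
(* Inverting exp (-1/2) >= 1 - 1/2 gives exp (1/2) <= 2. *)
have : 2^-1 <= expR (- 2^-1) :> R by have := expR_ge1Dx (- 2^-1 : R); lra.
rewrite expRN -[X in X <= _]/(2^-1 : R) lef_pV2 ?posrE ?expR_gt0//.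
Qed.

End calibration.

(** * From testing to the minimax risk *)

Section risk.
Context {R : realType} d (Omega : measurableType d) (P : probability Omega R).
Variable W : R -> Omega -> R.
Hypothesis BM : is_std_BM P W.

Lemma affine_class_G (b : R) : 0 <= b <= 1 -> class_G (fun x => x + b).
Proof.
move=> /andP[b0 b1]; split => [x /andP[x0 _]|]; first exact: addr_ge0.
exists 1, b; split => [x|]; first by rewrite mul1r.
by rewrite normr1 ger0_norm//; lra.
Qed.

(** The error event of T under f(x) = x is used as a test. Outside it T is close to 0, hence far
    from b, so both test errors bound the risk from below. *)
Lemma worst_risk_ge n T : (5 <= n)%N -> measurable_estimator T ->
  ((8^-1)%:E <= worst_risk P W 8^-1 n T)%E.
Proof.
move=> n5 mT.
pose r : R := Num.sqrt (n%:R * ln n%:R).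
pose b : R := 4^-1 / r.
pose c : R := (Num.sqrt n%:R)^-1.
have b0 : 0 < b := gap_gt0 n5.
have r0 : 0 < r by move: b0; rewrite /b pmulr_rgt0// invr_gt0.
have sn0 : 0 < Num.sqrt n%:R :> R by rewrite sqrtr_gt0 ltr0n (leq_trans _ n5).
have c0 : c != 0 by rewrite invr_eq0 gt_eqF.
(* The factor n comes from dividing the increments by the noise level [c] before squaring. *)
pose Q t : R := 4 * b ^+ 2 * n%:R * ln (t + b).
have FQ s t : 0 <= s -> s < t -> t <= 1 ->
    (((signal b t - signal 0 t) - (signal b s - signal 0 s)) / c) ^+ 2 <=
    (t - s) * (Q t - Q s).
  move=> s0 st t1; rewrite /c invrK exprMn sqr_sqrtr// /Q -mulrBr.
  rewrite mulrC.
  have -> : (t - s) * (4 * b ^+ 2 * n%:R * (ln (t + b) - ln (s + b))) =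
     n%:R * ((t - s) * (4 * b ^+ 2 * (ln (t + b) - ln (s + b)))) by ring.
  by rewrite ler_wpM2l//; exact: signal_diff_bound.
have expQ : expR (Q 1 - Q 0) <= 2.
  by rewrite /Q -mulrBr; exact: likelihood_bound.
have F00 : signal 0 0 = signal b 0 by rewrite !signal0.
have mset (a : R) : <<s @path_cylinders R >> [set y | 8^-1 <= `|T y - a| / r^-1].
  pose B := [set x : R | 8^-1 <= `|x - a| / r^-1].
  have mB : measurable B.
    have mf : measurable_fun setT (fun x : R => `|x - a| / r^-1).
      apply: measurable_funM => //.
      by apply: measurableT_comp => //; exact: measurable_funB.
    rewrite (_ : B = (fun x : R => `|x - a| / r^-1) @^-1` `[8^-1, +oo[); last first.
      by apply/seteqP; split => x; rewrite /= in_itv/= andbT.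
    by rewrite -[X in measurable X]setTI; exact: mf.
  exact: mT mB.
have sup f : class_G f -> f 0 <= c ->
   (P [set w | (8^-1 <= `|T (obs_path W n f w) - f 0| / r^-1)%R] <=
    worst_risk P W 8^-1 n T)%E.
  by move=> Gf f0; apply: ereal_sup_ubound; exists f.
(* Here [0 + 0] is the value at 0 of [fun x => x + 0], the form in which the signal with b = 0
   appears. *)
have [h|h] := testing_bound BM c0 F00 FQ expQ (mset (0 + 0)).
  apply: le_trans h _.
  apply: (sup (fun x => x + 0)); first by apply: affine_class_G; rewrite lexx ler01.
  by rewrite addr0 invr_ge0 ltW.
apply: le_trans h _.
apply: le_trans (sup (fun x => x + b) _ _); last 2 first.
- by apply: affine_class_G; rewrite ltW//= gap_le1.
- by rewrite add0r gap_le.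
apply: le_measure; rewrite ?inE.
- rewrite -[X in measurable X]setTI.
  apply: (measurable_signal_path BM c (signal b)) => //.
  by apply: measurableC; exact: mset.
- rewrite -[X in measurable X]setTI.
  exact: (measurable_signal_path BM c (signal b) measurableT (mset (0 + b))).
- move=> w /= /negP; rewrite -ltNge !add0r => lt0.
  change (8^-1 <= `|T (signal_path W c (signal b) w) - b| / r^-1).
  move: lt0; rewrite subr0 !invrK.
  set y := T _ => lt0.
  (* Since |y - b| r + |y| r >= b r = 1/4 and |y| r < 1/8, the error under x + b exceeds the
     threshold. *)
  have bE : b * r = 4^-1 by rewrite /b divfK// gt_eqF.
  have h : b <= `|y - b| + `|y|.
    by have := ler_norm y; have := ler_norm (b - y); rewrite distrC; lra.
  by have := ler_wpM2r (ltW r0) h; rewrite bE mulrDl; lra.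
Qed.

End risk.

Theorem theorem3p3 (R : realType) :
  exists C : R, 0 < C /\
    forall (d : measure_display) (Omega : measurableType d)
           (P : probability Omega R) (W : R -> Omega -> R),
      is_std_BM P W ->
      (0 < limn_einf (fun n => minimax_risk P W C n))%E.
Proof.
(* The number 1/8 serves both as the threshold C and as the lower bound on the probability. *)
exists 8^-1; split; first by rewrite invr_gt0.
move=> d Omega P W BM.
apply: (@lt_le_trans _ _ (8^-1)%:E); first by rewrite lte_fin invr_gt0.
rewrite limn_einf_lim; apply: lime_ge; first exact: is_cvg_einfs.
(* The lower limit is the limit of infima over tails, and every tail starting at 5 or later has
   infimum at least 1/8. *)
exists 5%N => // m /= m5; apply: le_ereal_inf_tmp => _ [k /= mk <-].
apply: le_ereal_inf_tmp => _ [T mT <-].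
by apply: worst_risk_ge => //; exact: leq_trans mk.
Qed.
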